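(* Let $G$ and $H$ be arbitrary non-trivial graphs where $H$ is not a complete graph. Then $$tn(G\circ H)=\min\{|A|+2\cdot|B|+tn(H)\cdot|C| \,:\, (A,B,C)\text{ is a toll-dominating triple of }G\}.$$
   Context: All graphs are finite, undirected, without loops or multiple edges; a graph is non-trivial if it has at least two vertices. $N_F(x)$ is the open neighborhood of $x$ in $F$. The lexicographic product $G\circ H$ has vertex set $V(G)\times V(H)$, and $(g_1,h_1)$, $(g_2,h_2)$ are adjacent if either $g_1g_2\in E(G)$ or ($g_1=g_2$ and $h_1h_2\in E(H)$). For distinct non-adjacent vertices $u,v$ of a graph $F$, a tolled walk between $u$ and $v$ is a sequence of vertices $u,w_1,\ldots,w_k,v$ with $k\ge 1$ such that $w_iw_{i+1}\in E(F)$ for all $1\le i<k$, $uw_i\in E(F)$ if and only if $i=1$, and $vw_i\in E(F)$ if and only if $i=k$. If $uv\in E(F)$, the only tolled walk between $u$ and $v$ is $u,v$; the only tolled walk from $v$ to $v$ is $v$ itself. The toll interval $T_F(u,v)$ is the set of all vertices lying on some tolled walk between $u$ and $v$. A set $S\subseteq V(F)$ is a toll set of $F$ if $\bigcup_{u,v\in S}T_F(u,v)=V(F)$. The toll number $tn(F)$ is the minimum size of a toll set of $F$. Let $A,B,C$ be pairwise disjoint (possibly empty) subsets of $V(G)$. Then $(A,B,C)$ is a toll-dominating triple of $G$ if for any $x\in V(G)-C$ there exist $u,v\in A\cup B\cup C$ with $x\in T_G(u,v)-\{u,v\}$ or there exists $w\in B\cup C$ with $x\in N_G(w)$. *)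

(* Defs.v *)
From mathcomp Require Import all_boot.
From mathcomp Require Import boolp.

Set Implicit Arguments.
Unset Strict Implicit.
Unset Printing Implicit Defensive.

Record sgraph := SGraph {
  vertex :> finType;
  edge : rel vertex;
  edge_sym : symmetric edge;
  edge_irrefl : irreflexive edge }.

Notation "x -- y" := (edge x y) (at level 30).

Definition nontrivial (F : sgraph) : Prop := 1 < #|F|.

Definition complete (F : sgraph) : Prop := forall x y : F, x != y -> x -- y.

Section LexicographicProduct.
Variables G H : sgraph.

Definition lex_edge : rel (G * H)%type :=
  fun x y => (x.1 -- y.1) || ((x.1 == y.1) && (x.2 -- y.2)).

Lemma lex_edge_sym : symmetric lex_edge.
Proof. by move=> x y; rewrite /lex_edge edge_sym eq_sym [x.2 -- _]edge_sym. Qed.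

Lemma lex_edge_irrefl : irreflexive lex_edge.
Proof. by move=> x; rewrite /lex_edge !edge_irrefl andbF. Qed.

Definition lexprod : sgraph := SGraph lex_edge_sym lex_edge_irrefl.

End LexicographicProduct.

(* [min_value t0 P f] is the minimum of [f] over the elements satisfying [P].
   The element [t0] is only a witness that [P] is satisfiable: the value does
   not depend on it as long as [P t0] holds (see [min_valueP]). *)
Definition min_value (T : finType) (t0 : T) (P : pred T) (f : T -> nat) : nat :=
  f [arg min_(t < t0 | P t) f t].

Lemma min_valueP (T : finType) (t0 : T) (P : pred T) (f : T -> nat) :
  P t0 ->
  (exists2 t, P t & f t = min_value t0 P f) /\
  (forall t, P t -> min_value t0 P f <= f t).
Proof.
by move=> Pt0; rewrite /min_value; case: arg_minnP => // t Pt le_t; split; [exists t|].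
Qed.

Section Toll.
Variable F : sgraph.
Implicit Types (u v x : F) (s w : seq F) (S : {set F}).

(* [tolled_walk u v s]: the full vertex sequence [s], endpoints included, is a
   tolled walk between [u] and [v]. Indices of [w] start at 0, so [w_1] and
   [w_k] are the entries of [w] at positions 0 and [(size w).-1]. *)
Inductive tolled_walk u v : seq F -> Prop :=
| TolledTrivial : u = v -> tolled_walk u v [:: u]
| TolledEdge : u -- v -> tolled_walk u v [:: u; v]
| TolledWalk w :
    u != v -> ~~ (u -- v) -> 0 < size w ->
    (forall i, i.+1 < size w -> nth u w i -- nth u w i.+1) ->
    (forall i, i < size w -> (u -- nth u w i) = (i == 0)) ->
    (forall i, i < size w -> (v -- nth u w i) = (i == (size w).-1)) ->
    tolled_walk u v (u :: rcons w v).

Definition toll_interval u v : {set F} :=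
  [set x | `[< exists2 s, tolled_walk u v s & x \in s >]].

Definition toll_set S : bool :=
  \bigcup_(u in S) \bigcup_(v in S) toll_interval u v == [set: F].

Lemma toll_set_setT : toll_set [set: F].
Proof.
apply/eqP/setP => x; rewrite [RHS]inE.
apply/bigcupP; exists x; rewrite ?inE //.
apply/bigcupP; exists x; rewrite ?inE //.
by apply/asboolP; exists [:: x]; [exact: TolledTrivial | rewrite inE].
Qed.

Definition toll_number : nat :=
  min_value [set: F] toll_set (fun S => #|S|).

Definition toll_dominating_triple (A B C : {set F}) : bool :=
  [&& [disjoint A & B], [disjoint A & C], [disjoint B & C] &
    [forall x in ~: C,
      [exists u in A :|: B :|: C, exists v in A :|: B :|: C,
         x \in toll_interval u v :\: [set u; v]]
      || [exists w in B :|: C, w -- x]]].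

Lemma toll_dominating_triple_setT : toll_dominating_triple set0 set0 [set: F].
Proof.
rewrite /toll_dominating_triple -!setI_eq0 !set0I !eqxx /=.
by apply/forall_inP => x; rewrite !inE.
Qed.

End Toll.

(* Main.v *)
Require Import Defs.
From mathcomp Require Import all_boot.
From mathcomp Require Import boolp.

Set Implicit Arguments.
Unset Strict Implicit.
Unset Printing Implicit Defensive.

(** The two sides are compared by turning toll sets of G o H into triples of G
    and back; the fibre of S over g is the set of h with (g, h) in S.

    From a triple (A, B, C), put one vertex of H over each g in A, two
    non-adjacent ones over each g in B, and a minimum toll set SH of H over
    each g in C. As H is not complete, SH also contains two non-adjacent
    vertices ([toll_set_nonadjacent]), so vertices over g in C do whatever those
    over g in B do. The result is a toll set ([toll_set_lex_of_triple]), since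
    induced embeddings carry tolled walks to tolled walks
    ([toll_interval_map]): copies of H cover the layers over C, graphs of
    functions G -> H lift the walks of G, and a vertex w of B or C covers the
    layers over N(w) by walks through a single common neighbor.

    From a toll set S, let C be the set of g whose fibre is a toll set of H,
    hence has at least tn(H) elements, and split the other g with a nonempty
    fibre into B and A according to whether the fibre has at least two
    elements. The cost of this triple is bounded by #|S| fibre by fibre. That
    it is toll-dominating rests on the classification [lex_toll_intervalP] of
    the ways in which x = (g, h) can lie in the interval of u and v: x is an
    endpoint; or the walk stays in the layer of g and h lies in an interval of
    H; or u and v lie in a common layer over a neighbor of g; or g lies
    strictly inside the interval of the projections of u and v. If the fibre
    over g is not a toll set of H, the first two cannot account for every h,
    and the last two are the two ways of dominating g.

    The classification comes from viewing layers as homogeneous sets (modules):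
    every outer vertex sees all of the layer or none of it. A tolled walk that
    is in the layer of its first endpoint u cannot leave it, because the vertex
    at which it leaves would be a second neighbor of u on the walk. *)

(** * Tolled walks and homogeneous sets *)

Section InnerWalks.
Variable F : sgraph.
Implicit Types (u v x y : F) (w s : seq F) (M : {set F}).

(** Non-trivial tolled walks, with the interior w as data. Listing the
    conditions as a path and two [all] makes the notion symmetric under
    reversal and suited to splitting w; w is nonempty because u -- v fails. *)
Definition inner_walk u v w : Prop :=
  [/\ u != v, ~~ (u -- v), path (@edge F) u (rcons w v),
      all (fun x => ~~ (u -- x)) (behead w)
    & all (fun x => ~~ (v -- x)) (behead (rev w))].

Variant tolled_walk_spec u v : seq F -> Prop :=
| TolledShort s : {subset s <= [:: u; v]} -> tolled_walk_spec u v s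
| TolledInner w : inner_walk u v w -> tolled_walk_spec u v (u :: rcons w v).

Lemma tolled_walkP u v s : tolled_walk u v s -> tolled_walk_spec u v s.
Proof.
case: s / => [->|_|w neq_uv nadj_uv w_gt0 w_path w_u w_v].
- by apply: TolledShort => x; rewrite !inE => ->.
- exact: TolledShort.
apply: TolledInner; split=> //.
- case: w w_gt0 w_path w_u w_v => //= a s _ w_path w_u w_v.
  have/= -> := w_u 0 isT; rewrite /= rcons_path; apply/andP; split.
    by apply/(pathP u) => i lt_is; apply: (w_path i).
  have/= := w_v (size s) (ltnSn _).
  by rewrite eqxx (nth_last u (a :: s)) edge_sym.
- case: w w_gt0 {w_path w_v} w_u => //= a s _ w_u.
  by apply/(all_nthP u) => i lt_is; rewrite (w_u i.+1).
- case/lastP: w w_gt0 {w_path w_u} w_v => // s b _ w_v.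
  rewrite rev_rcons /= all_rev; apply/(all_nthP u) => i lt_is.
  have := w_v i; rewrite size_rcons nth_rcons lt_is ltnW // => /(_ isT) ->.
  by rewrite /= ltn_eqF.
Qed.

Lemma inner_walk_rev u v w : inner_walk u v w -> inner_walk v u (rev w).
Proof.
case=> neq_uv nadj_uv w_path w_u w_v; split; rewrite ?revK 1?eq_sym 1?edge_sym //.
have eq_edge : (fun x => (@edge F)^~ x) =2 (@edge F) by move=> x y; apply: edge_sym.
have := rev_path (@edge F) u (rcons w v).
by rewrite last_rcons belast_rcons rev_cons => ->; rewrite (eq_path eq_edge).
Qed.

Lemma inner_walk_tolled u v w : inner_walk u v w -> tolled_walk u v (u :: rcons w v).
Proof.
case=> neq_uv nadj_uv w_path w_u w_v.
have w_gt0 : 0 < size w by case: w w_path {w_u w_v} => //=; rewrite andbT (negPf nadj_uv).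
apply: TolledWalk => //.
- case: w w_gt0 w_path {w_u w_v} => // a s _ /= /andP[_].
  by rewrite rcons_path => /andP[/(pathP u)].
- case: w w_gt0 w_path w_u {w_v} => // a s _ /= /andP[adj_ua _] /(all_nthP u) s_u [|i] //.
  by move=> lt_is; rewrite /= (negPf (s_u i lt_is)).
case/lastP: w w_gt0 w_path w_v {w_u} => // s b _ w_path.
rewrite rev_rcons /= all_rev => /(all_nthP u) s_v i.
rewrite size_rcons ltnS leq_eqVlt => /predU1P[->|lt_is].
  move: w_path; rewrite rcons_path last_rcons => /andP[_].
  by rewrite nth_rcons ltnn !eqxx edge_sym.
by rewrite nth_rcons lt_is /= (ltn_eqF lt_is) (negPf (s_v i lt_is)).
Qed.

(** Homogeneous sets are also known as modules. *)
Definition homogeneous M : Prop :=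
  forall x y z, x \in M -> y \in M -> z \notin M -> (x -- z) = (y -- z).

(** Leaving M would mean stepping to a vertex adjacent to a member of M, hence
    to u. *)
Lemma homogeneous_path M u x s :
  homogeneous M -> u \in M -> x \in M -> path (@edge F) x s ->
  all (fun y => ~~ (u -- y)) s -> all [in M] s.
Proof.
move=> homM uM; elim: s x => //= y s IHs x xM /andP[adj_xy y_s] /andP[nadj_uy s_u].
have yM : y \in M.
  by apply: contraNT nadj_uy => yM'; rewrite -(homM _ _ _ xM uM yM').
by rewrite yM (IHs y).
Qed.

Lemma inner_walk_homogeneous_tail M u v p y q :
  homogeneous M -> u \in M -> y \in M -> inner_walk u v (p ++ y :: q) ->
  all [in M] (rcons q v).
Proof.
move=> homM uM yM [_ nadj_uv w_path w_u _]; apply: (homogeneous_path (u := u) homM uM yM).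
  by move: w_path; rewrite rcons_cat cat_path => /andP[_ /= /andP[]].
rewrite all_rcons nadj_uv; apply/allP=> z zq; apply: (allP w_u).
by case: p {w_path w_u} => [|a p] //=; rewrite mem_cat inE zq !orbT.
Qed.

(** Once in M the walk cannot leave it, not even for its last step to v. *)
Lemma inner_walk_avoid M u v w y :
  homogeneous M -> u \in M -> v \notin M -> inner_walk u v w -> y \in w ->
  y \notin M.
Proof.
move=> homM uM vM' walk_w yw; apply: contra vM' => yM.
case/splitPr: yw walk_w => p q /(inner_walk_homogeneous_tail homM uM yM).
by rewrite all_rcons => /andP[].
Qed.

(** The walk cannot leave M after y, and by reversal cannot have been outside
    M before y. *)
Lemma inner_walk_within M u v w y :
  homogeneous M -> u \in M -> v \in M -> inner_walk u v w -> y \in w ->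
  y \in M -> {subset w <= M}.
Proof.
move=> homM uM vM walk_w yw yM; case/splitPr: yw walk_w => p q walk_w.
have:= inner_walk_homogeneous_tail homM uM yM walk_w.
have:= inner_walk_rev walk_w; rewrite rev_cat rev_cons cat_rcons.
move/(inner_walk_homogeneous_tail homM vM yM).
rewrite !all_rcons all_rev => /andP[_ /allP pM] /andP[_ /allP qM] z.
by rewrite mem_cat inE => /or3P[/pM|/eqP->|/qM].
Qed.

(** Such a walk starts outside M, so its first inner vertex is adjacent to v
    as well as to u and must also be the last one: y is that vertex. *)
Lemma inner_walk_outside M u v w y :
  homogeneous M -> u \in M -> v \in M -> inner_walk u v w -> y \in w ->
  y \notin M -> u -- y.
Proof.
move=> homM uM vM walk_w yw yM'; case: w walk_w yw => // a s walk_w yw.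
have aM' : a \notin M.
  apply: contra yM' => aM.
  exact: (inner_walk_within homM uM vM walk_w (mem_head a s) aM).
have [_ _ /= /andP[adj_ua _] _ w_v] := walk_w.
have adj_va : v -- a by rewrite (homM _ _ _ vM uM aM').
case/lastP: s {walk_w} yw w_v => [|s b _]; first by rewrite inE => /eqP->.
by rewrite rev_cons rev_rcons /= all_rcons adj_va.
Qed.

End InnerWalks.

(** * Removing repetitions from projected walks

    Projecting a walk of a lexicographic product to its first factor yields a
    sequence whose consecutive vertices are equal or adjacent. *)

Section Destutter.
Variable T : eqType.
Implicit Types (x y b : T) (s : seq T) (e : rel T).

(** Here x is the vertex preceding s. *)
Fixpoint destutter x s :=
  if s is y :: s' then if x == y then destutter x s' else y :: destutter y s'
  else [::].

Lemma destutter_subset x s : {subset destutter x s <= s}.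
Proof.
elim: s x => //= y s IHs x z; case: ifP => _; rewrite !inE.
  by move/IHs->; rewrite orbT.
by case/predU1P=> [->|/IHs->]; rewrite ?eqxx ?orbT.
Qed.

Lemma mem_destutter x y s : y \in s -> y != x -> y \in destutter x s.
Proof.
elim: s x => //= z s IHs x; rewrite inE => /predU1P[->|ys] neq_yx.
  by rewrite eq_sym (negPf neq_yx) mem_head.
case: ifP => _; first exact: IHs.
by rewrite inE; have [->|neq_yz] := eqVneq y z; rewrite ?IHs ?orbT.
Qed.

Lemma destutter_rcons x s b :
  destutter x (rcons s b) =
  if last x s == b then destutter x s else rcons (destutter x s) b.
Proof.
by elim: s x => //= y s IHs x; case: eqVneq => [<-|_]; rewrite IHs //; case: ifP.
Qed.

Lemma path_destutter e x s b :
  path (relU (@eq_op T) e) x (rcons s b) -> b \notin x :: s ->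
  path e x (rcons (destutter x s) b).
Proof.
elim: s x => /= [|y s IHs] x; rewrite !inE.
  by rewrite eq_sym !andbT => /orP[->|].
case: eqVneq => /= [<- x_s|neq_xy /andP[adj_xy y_s]].
  by rewrite orbA orbb; apply: IHs.
by rewrite negb_or adj_xy => /andP[_]; exact: IHs.
Qed.

End Destutter.

Lemma inner_walk_destutter (F : sgraph) (u v : F) (w : seq F) :
  u != v -> ~~ (u -- v) -> u \notin w -> v \notin w ->
  path (relU (@eq_op F) (@edge F)) u (rcons w v) ->
  all (fun x => ~~ (u -- x)) (behead w) ->
  all (fun x => ~~ (v -- x)) (behead (rev w)) ->
  inner_walk u v (destutter u w).
Proof.
move=> neq_uv nadj_uv uw vw w_path w_u w_v; split=> //.
- by apply: path_destutter => //; rewrite inE eq_sym negb_or neq_uv.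
- case: w uw w_u {vw w_path w_v} => //= a s; rewrite inE negb_or => /andP[/negPf-> _].
  by move=> /allP s_u; apply/allP=> x /destutter_subset/s_u.
case/lastP: w uw vw w_path w_v {w_u} => // s b.
rewrite !mem_rcons !inE !negb_or => /andP[neq_ub us] /andP[neq_vb _] w_path.
rewrite rev_rcons /= all_rev => /allP s_v.
have adj_vb : v -- b.
  move: w_path; rewrite rcons_path last_rcons /= eq_sym (negPf neq_vb) edge_sym.
  by case/andP.
rewrite destutter_rcons ifN; last first.
  case/lastP: s {w_path us} s_v => [|s c] s_v //; rewrite last_rcons.
  by apply: contraTneq adj_vb => <-; apply: s_v; rewrite mem_rcons mem_head.
by rewrite rev_rcons /= all_rev; apply/allP=> x /destutter_subset/s_v.
Qed.

(** * Toll intervals and toll sets *)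

(** Only induced adjacency along s matters, so this applies both to embeddings
    of a factor into the product and to projections that are injective along
    the walk. *)
Lemma tolled_walk_map (F K : sgraph) (f : F -> K) (u v : F) (s : seq F) :
  {in s &, forall x y, (f x -- f y) = (x -- y)} -> {in s &, injective f} ->
  tolled_walk u v s -> tolled_walk (f u) (f v) (map f s).
Proof.
move=> f_edge f_inj walk_s; case: walk_s f_edge f_inj.
- by move=> -> _ _; apply: TolledTrivial.
- move=> adj_uv f_edge _; apply: TolledEdge.
  by rewrite f_edge // !inE eqxx ?orbT.
move=> w neq_uv nadj_uv w_gt0 w_path w_u w_v f_edge f_inj; rewrite /= map_rcons.
have us : u \in u :: rcons w v by rewrite mem_head.
have vs : v \in u :: rcons w v by rewrite inE mem_rcons mem_head orbT.
have ws i : i < size w -> nth u w i \in u :: rcons w v.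
  by move=> lt_iw; rewrite inE mem_rcons inE mem_nth ?orbT.
apply: TolledWalk; rewrite ?size_map //.
- by apply: contra neq_uv => /eqP/f_inj->.
- by rewrite f_edge.
- by move=> i lt_iw; rewrite !(nth_map u) ?f_edge ?w_path ?ws // ltnW.
- by move=> i lt_iw; rewrite !(nth_map u) ?f_edge ?w_u ?ws.
- by move=> i lt_iw; rewrite !(nth_map u) ?f_edge ?w_v ?ws.
Qed.

Lemma toll_intervalP (F : sgraph) (u v x : F) :
  reflect (exists2 s, tolled_walk u v s & x \in s) (x \in toll_interval u v).
Proof. by rewrite inE; apply: asboolP. Qed.

Lemma toll_interval_map (F K : sgraph) (f : F -> K) (u v x : F) :
  {mono f : y z / y -- z} -> injective f ->
  x \in toll_interval u v -> f x \in toll_interval (f u) (f v).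
Proof.
move=> f_edge f_inj /toll_intervalP[s walk_s xs]; apply/toll_intervalP.
exists (map f s); last exact: map_f.
apply: tolled_walk_map walk_s; first by move=> y z _ _; apply: f_edge.
by move=> y z _ _; apply: f_inj.
Qed.

Lemma toll_setP (F : sgraph) (S : {set F}) :
  reflect (forall x, exists2 u, u \in S & exists2 v, v \in S & x \in toll_interval u v)
          (toll_set S).
Proof.
apply: (iffP eqP) => [eqST x|S_toll].
  have: x \in [set: F] by rewrite inE.
  rewrite -eqST => /bigcupP[u uS /bigcupP[v vS xuv]].
  by exists u => //; exists v.
apply/setP=> x; rewrite [RHS]inE; have [u uS [v vS xuv]] := S_toll x.
by apply/bigcupP; exists u => //; apply/bigcupP; exists v.
Qed.

Lemma toll_interval_refl (F : sgraph) (x : F) : x \in toll_interval x x.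
Proof. by apply/toll_intervalP; exists [:: x]; [apply: TolledTrivial|rewrite inE]. Qed.

Lemma toll_interval_common_neighbor (F : sgraph) (u v x : F) :
  u != v -> ~~ (u -- v) -> u -- x -> v -- x -> x \in toll_interval u v.
Proof.
move=> neq_uv nadj_uv adj_ux adj_vx; apply/toll_intervalP.
exists [:: u; x; v]; last by rewrite !inE eqxx orbT.
apply: (@inner_walk_tolled _ _ _ [:: x]); split=> //=.
by rewrite adj_ux edge_sym adj_vx.
Qed.

(** Only distinct non-adjacent endpoints have other vertices in their interval,
    so a toll set that is a clique is the whole graph, which is then complete. *)
Lemma toll_set_nonadjacent (F : sgraph) (S : {set F}) :
  ~ complete F -> toll_set S ->
  exists u v, [/\ u \in S, v \in S, u != v & ~~ (u -- v)].
Proof.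
move=> F_ncomplete /toll_setP S_toll; apply: contrapT => S_clique; apply: F_ncomplete.
have S_adj u v : u \in S -> v \in S -> u != v -> u -- v.
  move=> uS vS neq_uv; apply: contrapT => /negP nadj_uv; apply: S_clique.
  by exists u, v.
suff S_full x : x \in S by move=> x y; apply: S_adj.
have [u uS [v vS /toll_intervalP[s walk_s]]] := S_toll x.
case: s / {walk_s}(tolled_walkP walk_s) => [s s_uv /s_uv|w [neq_uv + _ _ _]].
  by rewrite !inE => /orP[]/eqP->.
by rewrite S_adj.
Qed.

(** * Lexicographic products *)

Section Lexprod.
Variables G H : sgraph.
Implicit Types (g : G) (h : H) (u v x y : lexprod G H) (S : {set lexprod G H}).

Definition layer g : {set lexprod G H} := [set x | x.1 == g].

Definition fibre S g : {set H} := [set h | ((g, h) : lexprod G H) \in S].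

Definition toll_fibres S : {set G} := [set g | toll_set (fibre S g)].

Definition plural_fibres S : {set G} :=
  [set g in ~: toll_fibres S | 1 < #|fibre S g|].

Definition single_fibres S : {set G} :=
  [set g in ~: toll_fibres S | #|fibre S g| == 1].

Lemma lex_edgeE u v :
  (u -- v) = (u.1 -- v.1) || ((u.1 == v.1) && (u.2 -- v.2)).
Proof. by []. Qed.

(** Outside the layer of g, adjacency to (g, h) does not depend on h. *)
Lemma homogeneous_layer g : homogeneous (layer g).
Proof.
move=> x y z; rewrite !inE => /eqP xg /eqP yg; rewrite !lex_edgeE xg yg eq_sym.
by move=> /negPf->.
Qed.

Lemma card_fibres S : #|S| = \sum_g #|fibre S g|.
Proof.
rewrite -sum1_card (partition_big (fun x => x.1) xpredT) //=.
apply: eq_bigr => g _; rewrite sum1dep_card.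
rewrite -(card_imset _ (f := fun h : H => (g, h) : lexprod G H)); last by move=> h k [].
apply: eq_card => -[g' h]; rewrite inE /=; apply/andP/imsetP.
  by case=> xS /eqP eg; exists h; rewrite ?inE -?eg.
by case=> k; rewrite inE => kS [-> ->].
Qed.

(** The walk avoids the layers of both endpoints, so adjacency of its vertices
    to an endpoint is decided by first components, and the projected walk
    satisfies the conditions at both ends. *)
Lemma inner_walk_fst u v w x :
  inner_walk u v w -> u.1 != v.1 -> x \in w ->
  x.1 \in toll_interval u.1 v.1 :\: [set u.1; v.1].
Proof.
move=> walk_w neq_uv1 xw; have [_ nadj_uv w_path w_u w_v] := walk_w.
have nadj_fst y z : ~~ (y -- z) -> ~~ (y.1 -- z.1) by rewrite lex_edgeE => /norP[].
have wu1 y : y \in w -> y.1 != u.1.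
  have := @inner_walk_avoid _ _ _ _ _ y (@homogeneous_layer u.1) _ _ walk_w.
  by rewrite !inE eqxx [v.1 == _]eq_sym => /(_ isT neq_uv1).
have wv1 y : y \in w -> y.1 != v.1.
  have := @inner_walk_avoid _ _ _ _ _ y (@homogeneous_layer v.1) _ _ (inner_walk_rev walk_w).
  by rewrite !inE mem_rev eqxx => /(_ isT neq_uv1).
have walk1 : inner_walk u.1 v.1 (destutter u.1 [seq y.1 | y <- w]).
  apply: inner_walk_destutter => //; first exact: nadj_fst.
  - by apply/mapP=> -[y /wu1/eqP neq_yu eq_yu]; apply: neq_yu.
  - by apply/mapP=> -[y /wv1/eqP neq_yv eq_yv]; apply: neq_yv.
  - rewrite -(map_rcons fst); apply: (homo_path (f := fst)) w_path => y z.
    by rewrite lex_edgeE /= => /orP[->|/andP[->]]; rewrite ?orbT.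
  - rewrite behead_map all_map; apply: sub_all w_u => y; exact: nadj_fst.
  - rewrite -map_rev behead_map all_map; apply: sub_all w_v => y; exact: nadj_fst.
rewrite in_setD in_set2 negb_or wu1 // wv1 //=; apply/toll_intervalP.
exists (u.1 :: rcons (destutter u.1 [seq y.1 | y <- w]) v.1).
  exact: inner_walk_tolled.
by rewrite inE mem_rcons inE mem_destutter ?orbT ?wu1 ?map_f.
Qed.

Variant lex_toll_spec u v x : Prop :=
| LexTollEnd of x \in [set u; v]
| LexTollLayer of u.1 = x.1 & v.1 = x.1 & x.2 \in toll_interval u.2 v.2
| LexTollNeighbor of u != v & u.1 = v.1 & u.1 -- x.1
| LexTollProj of x.1 \in toll_interval u.1 v.1 :\: [set u.1; v.1].

(** Endpoints in different layers give the projected walk. If they share a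
    layer, the walk is either inside it, and then it is a walk of H, or it
    consists of a single outer vertex. *)
Lemma lex_toll_intervalP u v x : x \in toll_interval u v -> lex_toll_spec u v x.
Proof.
case/toll_intervalP=> s walk_s xs; have walk_spec := tolled_walkP walk_s.
case: s / walk_spec walk_s xs.
  by move=> s s_uv _ /s_uv xuv; apply: LexTollEnd; rewrite !inE in xuv *.
move=> w walk_w walk_s; rewrite inE mem_rcons inE.
case/or3P=> [xu|xv|xw]; try by apply: LexTollEnd; rewrite !inE ?xu ?xv ?orbT.
have [eq_uv1|neq_uv1] := eqVneq u.1 v.1; last first.
  by apply: LexTollProj; apply: inner_walk_fst walk_w _ _.
have homL := @homogeneous_layer u.1.
have uL : u \in layer u.1 by rewrite inE.
have vL : v \in layer u.1 by rewrite inE eq_uv1.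
have [xL|xL'] := boolP (x \in layer u.1); last first.
  apply: LexTollNeighbor => //; first by case: walk_w.
  have := inner_walk_outside homL uL vL walk_w xw xL'.
  by move: xL'; rewrite inE lex_edgeE eq_sym => /negPf->; rewrite orbF.
have wL := inner_walk_within homL uL vL walk_w xw xL.
move: (xL); rewrite inE => /eqP eq_xu1.
apply: LexTollLayer; rewrite -?eq_uv1 ?eq_xu1 //; apply/toll_intervalP.
exists [seq y.2 | y <- u :: rcons w v]; last first.
  by apply/map_f; rewrite inE mem_rcons inE xw !orbT.
have sL y : y \in u :: rcons w v -> y.1 = u.1.
  by rewrite inE mem_rcons inE => /or3P[/eqP->|/eqP->|/wL] //; rewrite inE => /eqP.
apply: (@tolled_walk_map (lexprod G H) H snd) walk_s => y z /sL y1 /sL z1.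
  by rewrite lex_edgeE y1 z1 edge_irrefl eqxx.
by rewrite [y]surjective_pairing [z]surjective_pairing y1 z1 /= => ->.
Qed.

(** The graph of any f : G -> H is an induced copy of G; choosing f freely
    prescribes the second components of the endpoints and of g. *)
Lemma toll_interval_section (f : G -> H) (g1 g2 g : G) :
  g \in toll_interval g1 g2 ->
  ((g, f g) : lexprod G H) \in
    @toll_interval (lexprod G H) (g1, f g1) (g2, f g2).
Proof.
apply: (@toll_interval_map G (lexprod G H) (fun g => (g, f g))); last by move=> ? ? [].
move=> y z; rewrite lex_edgeE /=; case: eqVneq => [->|]; rewrite ?edge_irrefl ?orbF //.
Qed.

Lemma toll_interval_layer g h1 h2 h :
  h \in toll_interval h1 h2 ->
  ((g, h) : lexprod G H) \in
    @toll_interval (lexprod G H) (g, h1) (g, h2).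
Proof.
apply: (@toll_interval_map H (lexprod G H) (fun h => (g, h))); last by move=> ? ? [].
by move=> y z; rewrite lex_edgeE /= edge_irrefl eqxx.
Qed.

(** Over C the vertices are covered by intervals inside a layer; elsewhere
    the two clauses of domination give a lifted walk or a common neighbor. *)
Lemma toll_set_lex_of_triple (A B C : {set G}) S :
  toll_dominating_triple A B C ->
  (forall g, g \in A :|: B :|: C -> exists h, h \in fibre S g) ->
  (forall g, g \in B :|: C -> exists h1 h2,
     [/\ h1 \in fibre S g, h2 \in fibre S g, h1 != h2 & ~~ (h1 -- h2)]) ->
  (forall g, g \in C -> toll_set (fibre S g)) ->
  toll_set S.
Proof.
case/and4P=> _ _ _ /forall_inP dom S_ABC S_BC S_C; apply/toll_setP => -[g h].
have [gC|gC'] := boolP (g \in C).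
  have /toll_setP/(_ h)[h1 h1S [h2 h2S hT]] := S_C g gC; rewrite !inE in h1S h2S.
  by exists (g, h1) => //; exists (g, h2) => //; apply: toll_interval_layer.
have: g \in ~: C by rewrite inE.
case/dom/orP=> [/exists_inP[g1 g1ABC /exists_inP[g2 g2ABC]]|/exists_inP[k kBC adj_kg]].
  rewrite in_setD in_set2 negb_or -andbA => /and3P[neq_g1 neq_g2 gT].
  (* f meets S over the endpoints g1 and g2 and takes the value h at g; being a
     function, it stays consistent when g1 = g2. *)
  have /choice[k kS] : forall g', exists k, g' \in A :|: B :|: C -> k \in fibre S g'.
    move=> g'; have [/S_ABC[k kS]|_] := boolP (g' \in A :|: B :|: C); last by exists h.
    by exists k.
  pose f g' := if g' == g then h else k g'.
  have fS g' : g' != g -> g' \in A :|: B :|: C -> ((g', f g') : lexprod G H) \in S.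
    by rewrite /f => /negPf-> /kS; rewrite inE.
  exists (g1, f g1); first by rewrite fS // eq_sym.
  exists (g2, f g2); first by rewrite fS // eq_sym.
  by have := toll_interval_section f gT; rewrite {1}/f eqxx.
have [h1 [h2 []]] := S_BC _ kBC; rewrite !inE => h1S h2S neq_h nadj_h.
exists (k, h1) => //; exists (k, h2) => //; apply: toll_interval_common_neighbor.
- by rewrite xpair_eqE eqxx.
- by rewrite lex_edgeE /= edge_irrefl eqxx.
- by rewrite lex_edgeE /= adj_kg.
- by rewrite lex_edgeE /= adj_kg.
Qed.

End Lexprod.

(** If the fibre over g is not a toll set, some h lies in no interval of that
    fibre; an interval of S covering (g, h) must then come from outside the
    layer of g, which dominates g. *)
Lemma toll_dominating_triple_fibres (G H : sgraph) (S : {set lexprod G H}) :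
  toll_set S ->
  toll_dominating_triple (single_fibres S) (plural_fibres S) (toll_fibres S).
Proof.
move=> S_toll; rewrite /toll_dominating_triple.
set A := single_fibres S; set B := plural_fibres S; set C := toll_fibres S.
have fibreP (x : lexprod G H) : x \in S -> x.2 \in fibre S x.1.
  by rewrite inE -surjective_pairing.
have fibre_ABC (x : lexprod G H) : x \in S -> x.1 \in A :|: B :|: C.
  move=> /fibreP xS; have: 0 < #|fibre S x.1| by apply/card_gt0P; exists x.2.
  rewrite in_setU in_setU [_ \in A]inE [_ \in B]inE in_setC.
  by case: (_ \in C) => //=; rewrite orbF eq_sym leq_eqVlt.
apply/and4P; split.
- rewrite disjoint_subset; apply/subsetP=> g.
  rewrite [_ \in A]inE !inE => /andP[_ /eqP->]; by rewrite andbF.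
- by rewrite disjoint_subset; apply/subsetP=> g; rewrite [_ \in A]inE in_setC => /andP[].
- by rewrite disjoint_subset; apply/subsetP=> g; rewrite [_ \in B]inE in_setC => /andP[].
apply/forall_inP=> g; rewrite !inE => fibre_ntoll.
have [h h_uncov] : exists h, forall h1 h2,
    h1 \in fibre S g -> h2 \in fibre S g -> h \notin toll_interval h1 h2.
  apply: contrapT => all_cov; case/toll_setP: fibre_ntoll => h.
  apply: contrapT => h_uncov; apply: all_cov; exists h => h1 h2 h1S h2S.
  by apply/negP => hT; apply: h_uncov; exists h1 => //; exists h2.
have /toll_setP/(_ (g, h))[u uS [v vS /lex_toll_intervalP]] := S_toll.
case=> [|ug vg|neq_uv eq_uv1 adj_ug|gT].
- have ghS' : (g, h) \notin S.
    apply/negP => /fibreP hS; have := h_uncov _ _ hS hS.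
    by rewrite toll_interval_refl.
  by rewrite !inE => /orP[]/eqP ghE; rewrite ghE ?uS ?vS in ghS'.
- have := fibreP u uS; have := fibreP v vS; rewrite ug vg /= => h2S h1S.
  by rewrite (negPf (h_uncov _ _ h1S h2S)).
- apply/orP; right; apply/exists_inP; exists u.1 => //.
  rewrite in_setU [_ \in B]inE in_setC; case: (_ \in C) => //=; rewrite orbF.
  apply/card_gt1P; exists u.2, v.2; rewrite fibreP //; split=> //.
    by rewrite eq_uv1 fibreP.
  by apply: contraNneq neq_uv => eq_uv2;
     rewrite [u]surjective_pairing eq_uv1 eq_uv2 -surjective_pairing.
apply/orP; left; apply/exists_inP; exists u.1; first exact: fibre_ABC.
by apply/exists_inP; exists v.1; first exact: fibre_ABC.
Qed.

(** * The two inequalities *)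

Lemma triple_weight (F : sgraph) (A B C : {set F}) (t : nat) :
  #|A| + 2 * #|B| + t * #|C| =
  \sum_x ((x \in A) + 2 * (x \in B) + t * (x \in C)).
Proof.
have card_sum (X : {set F}) : #|X| = \sum_x (x \in X).
  by rewrite -sum1_card big_mkcond; apply: eq_bigr => x _; case: (x \in X).
by rewrite 3!card_sum !big_distrr -!big_split.
Qed.

Theorem theorem4p21 (G H : sgraph)
    (G_nontrivial : nontrivial G) (H_nontrivial : nontrivial H)
    (H_not_complete : ~ complete H) :
  toll_number (lexprod G H) =
  min_value (set0, set0, [set: G])
    (fun '(A, B, C) => toll_dominating_triple A B C)
    (fun '(A, B, C) => #|A| + 2 * #|B| + toll_number H * #|C|).
Proof.
set P := (fun '(A, B, C) => _); set f := (fun '(A, B, C) => _).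
have [[[[A B] C] ABC_dom ABC_min] f_min] :=
  @min_valueP _ (set0, set0, [set: G]) P f (toll_dominating_triple_setT G).
have [[S S_toll S_min] lex_min] :=
  @min_valueP _ [set: lexprod G H] _ (fun S : {set lexprod G H} => #|S|) (toll_set_setT (lexprod G H)).
have [[SH SH_toll SH_min] H_min] :=
  @min_valueP _ [set: H] _ (fun S : {set H} => #|S|) (toll_set_setT H).
rewrite -!/(toll_number _) in S_min lex_min SH_min H_min.
apply/eqP; rewrite eqn_leq; apply/andP; split.
  have [h1 [h2 [h1S h2S neq_h nadj_h]]] := toll_set_nonadjacent H_not_complete SH_toll.
  (* {h1} and {h1, h2} are subsets of SH, so h1 and h2 serve over every
     layer in question. *)
  pose X g := if g \in C then SH else if g \in B then [set h1; h2]
              else if g \in A then [set h1] else set0.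
  pose U : {set lexprod G H} := [set x | x.2 \in X x.1].
  have fibreU g : fibre U g = X g by apply/setP=> h; rewrite !inE.
  rewrite -ABC_min; apply: (@leq_trans #|U|); last first.
    rewrite card_fibres /f triple_weight; apply: leq_sum => g _; rewrite fibreU /X.
    case: (g \in C); first by rewrite SH_min muln1 leq_addl.
    case: (g \in B); first by rewrite cards2 neq_h muln0 addn0 leq_addl.
    by case: (g \in A); rewrite ?cards1 ?cards0.
  apply: lex_min; apply: (toll_set_lex_of_triple ABC_dom) => g; rewrite fibreU /X.
  - rewrite !in_setU => gABC; exists h1.
    case: (g \in C) gABC => //; case: (g \in B); first by rewrite set21.
    by rewrite !orbF => ->; rewrite set11.
  - rewrite in_setU => gBC; exists h1, h2.
    case: (g \in C) gBC => //; rewrite orbF => ->.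
    by rewrite set21 set22.
  - by move=> ->.
have := f_min (_, _, _) (toll_dominating_triple_fibres S_toll).
rewrite /f triple_weight -S_min card_fibres => /leq_trans; apply.
apply: leq_sum => g _; rewrite !inE.
have [/H_min|_] := boolP (toll_set (fibre S g)); first by rewrite muln1.
by rewrite muln0 addn0; case: #|fibre S g| => [|[|n]].
Qed.
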